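(* Let $R$ be a (commutative) domain, and let $m\colon \mathcal{F}\to\mathcal{G}$ be a morphism of Green functors with inflation (GFIs) over $R$, with kernel $\mathcal{K}$, such that $\mathcal{F}(H)$ is $R$-torsion free for all finite groups $H$. Let $G$ be a finite group, and let $D(G)$ be an $R$-subalgebra of the centre of $\mathcal{F}(G)$ such that the $R$-module $\mathcal{F}(G)$ is generated by $\mathcal{I}_{\mathcal{F}}(G)$ and $D(G)$. Suppose that there is a non-trivial normal subgroup $N$ of $G$ such that $G/N$ is not primordial for $\mathrm{Im}\, m$. Then $\mathrm{Prim}_{\mathcal{K},D}(G)$ is trivial.
   Context: Rings are associative with a unit element. An $R$-algebra is a ring $A$ with a ring homomorphism from $R$ to the centre of $A$; subalgebras contain $1$ and homomorphisms preserve $1$. A global Mackey functor with inflation (MFI) $\mathcal{F}$ over $R$ consists of: an $R$-module $\mathcal{F}(G)$ for every finite group $G$; an $R$-module homomorphism $\mathcal{F}_*(\alpha)\colon\mathcal{F}(H)\to\mathcal{F}(G)$ for every monomorphism $\alpha\colon H\to G$ of finite groups; an $R$-module homomorphism $\mathcal{F}^*(\epsilon)\colon\mathcal{F}(G)\to\mathcal{F}(H)$ for every homomorphism $\epsilon\colon H\to G$ of finite groups; such that: (MFI 1) $\mathcal{F}_*(\alpha\beta)=\mathcal{F}_*(\alpha)\mathcal{F}_*(\beta)$ for composable monomorphisms; (MFI 2) $\mathcal{F}^*(\alpha\beta)=\mathcal{F}^*(\beta)\mathcal{F}^*(\alpha)$ for composable homomorphisms; (MFI 3) $\mathcal{F}^*(\alpha)=\mathcal{F}_*(\alpha)=1$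 for inner automorphisms $\alpha$; (MFI 4) $\mathcal{F}_*(\alpha)=\mathcal{F}^*(\alpha^{-1})$ for automorphisms $\alpha$; (MFI 5) for monomorphisms $\alpha\colon H\to G$, $\beta\colon K\to G$, $\mathcal{F}^*(\beta)\mathcal{F}_*(\alpha)=\sum_{g\in\alpha(H)\backslash G/\beta(K)}\mathcal{F}_*(\phi_g)\mathcal{F}^*(\psi_g)$, where $\phi_g\colon \alpha(H)\cap g\beta(K)g^{-1}\to K$ is $x\mapsto \beta^{-1}(g^{-1}xg)$ and $\psi_g\colon\alpha(H)\cap g\beta(K)g^{-1}\to H$ is $x\mapsto\alpha^{-1}(x)$; (MFI 6) for every commutative square $\delta\alpha=\beta\epsilon$ with epimorphisms $\epsilon\colon H\to\bar H$, $\delta\colon G\to\bar G$ and monomorphisms $\alpha\colon H\to G$, $\beta\colon\bar H\to\bar G$ that is cartesian, i.e. $\alpha(H)=\delta^{-1}(\beta(\bar H))$, one has $\mathcal{F}^*(\delta)\mathcal{F}_*(\beta)=\mathcal{F}_*(\alpha)\mathcal{F}^*(\epsilon)$. For a subgroup $H\le G$ with inclusion $\alpha$, write $\mathrm{Ind}_{G/H}=\mathcal{F}_*(\alpha)$ and $\mathrm{Res}_{G/H}=\mathcal{F}^*(\alpha)$; for a normal subgroup $N$ with quotient map $\epsilon\colon G\to G/N$, write $\mathrm{Inf}_{G/N}=\mathcal{F}^*(\epsilon)$. A Green functor with inflation (GFI) over $R$ is an MFI $\mathcal{F}$ over $R$ such that each $\mathcal{F}(G)$ is an $R$-algebra, each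 $\mathcal{F}^*(\alpha)$ is an $R$-algebra homomorphism, and for every monomorphism $\alpha\colon H\to G$ and all $x\in\mathcal{F}(H)$, $y\in\mathcal{F}(G)$: $\mathcal{F}_*(\alpha)(x)\cdot y=\mathcal{F}_*(\alpha)(x\cdot\mathcal{F}^*(\alpha)(y))$ and $y\cdot\mathcal{F}_*(\alpha)(x)=\mathcal{F}_*(\alpha)(\mathcal{F}^*(\alpha)(y)\cdot x)$. A morphism $m\colon\mathcal{F}\to\mathcal{G}$ of GFIs is a collection of $R$-algebra homomorphisms $m_G\colon\mathcal{F}(G)\to\mathcal{G}(G)$, one for each finite group $G$, commuting with all $\mathcal{F}_*,\mathcal{G}_*$ and $\mathcal{F}^*,\mathcal{G}^*$. Its kernel $\mathcal{K}$, $\mathcal{K}(G)=\ker m_G$, and its image $\mathrm{Im}\,m$, $(\mathrm{Im}\,m)(G)=m_G(\mathcal{F}(G))$, carry the structure maps restricted from $\mathcal{F}$ and $\mathcal{G}$, respectively; $\mathcal{K}$ is an MFI and each $\mathcal{K}(G)$ is an ideal of $\mathcal{F}(G)$, and $\mathrm{Im}\,m$ is a GFI. For an MFI $\mathcal{M}$, $\mathcal{I}_{\mathcal{M}}(G)=\sum_{H\lneq G}\mathrm{Ind}_{G/H}\mathcal{M}(H)$. A finite group $G$ is primordial for $\mathcal{M}$ if either $G$ is trivial or $\mathcal{M}(G)\neq\mathcal{I}_{\mathcal{M}}(G)$. Finally, $\mathrm{Imprim}_{\mathcal{K},D}(G)=D(G)\cdot\big(\sum_{H\lneq G}\mathrm{Ind}_{G/H}\mathcal{K}(H)+\sum_{1\neq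 N\trianglelefteq G}\mathrm{Inf}_{G/N}\mathcal{K}(G/N)\big)\subseteq\mathcal{K}(G)$ (the $R$-submodule generated by the products, taken in $\mathcal{F}(G)$), and $\mathrm{Prim}_{\mathcal{K},D}(G)=\mathcal{K}(G)/\mathrm{Imprim}_{\mathcal{K},D}(G)$. *)

(* Defs.v *)
From HB Require Import structures.
From mathcomp Require Import all_boot all_order all_algebra all_fingroup.
From mathcomp Require Import boolp classical_sets.

Set Implicit Arguments.
Unset Strict Implicit.
Unset Printing Implicit Defensive.

Import GRing.Theory.

Local Open Scope classical_set_scope.
Local Open Scope quotient_scope.
Local Open Scope ring_scope.

(* The library's [algType R] extends [nzRingType] and so excludes the zero
   algebra; the values of a Green functor may be zero. *)
Record ralgebra (R : comNzRingType) := RAlgebra {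
  alg_ring : pzRingType;
  alg_map : {rmorphism R -> alg_ring};
  alg_central : forall r x, GRing.comm (alg_map r) x
}.

Definition alg_sort (R : comNzRingType) (A : ralgebra R) : Type := alg_ring A.
Coercion alg_sort : ralgebra >-> Sortclass.

Section RAlgebraModule.
Variables (R : comNzRingType) (A : ralgebra R).

HB.instance Definition _ := GRing.PzRing.on (alg_sort A).

Definition alg_scale (r : R) (x : A) : A := (alg_map A r : A) * x.

Lemma alg_scaleA r s x : alg_scale r (alg_scale s x) = alg_scale (r * s) x.
Proof. by rewrite /alg_scale mulrA -rmorphM. Qed.

Lemma alg_scale1 : left_id 1 alg_scale.
Proof. by move=> x; rewrite /alg_scale rmorph1 mul1r. Qed.

Lemma alg_scaleDr : right_distributive alg_scale +%R.
Proof. by move=> r x y; rewrite /alg_scale mulrDr. Qed.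

Lemma alg_scaleDl x : {morph alg_scale^~ x : r s / r + s}.
Proof. by move=> r s; rewrite /alg_scale rmorphD mulrDl. Qed.

HB.instance Definition _ := GRing.Zmodule_isLmodule.Build R (alg_sort A)
  alg_scaleA alg_scale1 alg_scaleDr alg_scaleDl.

End RAlgebraModule.

Definition torsion_free (R : pzRingType) (V : lmodType R) : Prop :=
  forall (r : R) (x : V), r *: x = 0 -> r = 0 \/ x = 0.

Definition submodule (R : pzRingType) (V : lmodType R) (S : set V) : Prop :=
  GRing.submod_closed [in S].

Definition Rspan (R : pzRingType) (V : lmodType R) (A : set V) : set V :=
  smallest (@submodule R V) A.

Definition subalgebra (R : comNzRingType) (A : ralgebra R) (S : set A) : Prop :=
  submodule S /\ GRing.mulr_closed [in S].

Definition centre (A : pzRingType) : set A :=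
  [set z | forall x, GRing.comm z x].

Arguments centre A _ : clear implicits.

Lemma submoduleP (R : pzRingType) (V : lmodType R) (S : set V) :
  submodule S <-> (S 0 /\ forall a x y, S x -> S y -> S (a *: x + y)).
Proof.
split=> [[S0 SD]|[S0 SD]].
  split=> [|a x y Sx Sy]; first by rewrite -in_setE.
  by rewrite -in_setE; apply: SD; rewrite in_setE.
split=> [|a x y]; first by rewrite in_setE.
by rewrite !in_setE; apply: SD.
Qed.

Lemma Rspan_submodule (R : pzRingType) (V : lmodType R) (A : set V) :
  submodule (Rspan A).
Proof.
apply/submoduleP; split=> [S [/submoduleP[S0 _] _]//|a x y Ax Ay S SA].
have [/submoduleP[_ SD] _] := SA.
by apply: SD; [apply: Ax | apply: Ay].
Qed.

Notation hom H G := (UMagmaMorphism.type H G).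

Record mono (H G : finGroupType) := Mono {
  mono_hom :> hom H G;
  mono_inj : injective mono_hom
}.

Definition mono_comp (K H G : finGroupType) (a : mono H G) (b : mono K H) :
  mono K G := @Mono K G (a \o b) (inj_comp (@mono_inj _ _ a) (@mono_inj _ _ b)).

Definition epi (H G : finGroupType) (f : hom H G) : Prop :=
  forall y : G, exists x : H, f x = y.

Section Homs.
Variables (H G : finGroupType).

Lemma img_group_set (f : hom H G) : group_set (f @: [set: H]%SET).
Proof.
apply/group_setP; split; first by apply/imsetP; exists 1%g; rewrite ?gmulf1 ?inE.
move=> _ _ /imsetP[x _ ->] /imsetP[y _ ->].
by apply/imsetP; exists (x * y)%g; rewrite ?gmulfM ?inE.
Qed.

Definition img (f : hom H G) : {group G} := Group (img_group_set f).

(* The inverse of [a] on its image, extended by 1. *)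
Definition mono_inv (a : mono H G) (y : G) : H :=
  odflt 1%g [pick x | a x == y].

Lemma mono_invK (a : mono H G) : {in img a, cancel (mono_inv a) a}.
Proof.
move=> y /imsetP[x _ ->]; rewrite /mono_inv; case: pickP => [z /eqP//|/(_ x)].
by rewrite eqxx.
Qed.

Lemma mono_invM (a : mono H G) :
  {in img a &, {morph mono_inv a : x y / (x * y)%g}}.
Proof.
move=> x y ax ay; apply: (@mono_inj _ _ a).
by rewrite gmulfM !mono_invK ?groupM.
Qed.

End Homs.

Section HomOfMorph.
Variables (H G : finGroupType) (f : H -> G) (fM : {morph f : x y / (x * y)%g}).

Lemma morph_monoid : monoid.monoid_morphism f.
Proof. by split=> //; apply: (mulgI (f 1%g)); rewrite -fM !mulg1. Qed.

Definition hom_of : hom H G :=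
  HB.pack f (isUMagmaMorphism.Build H G f morph_monoid).

End HomOfMorph.

Definition incl (G : finGroupType) (H : {group G}) : mono (subg_of H) G :=
  @Mono _ G (@hom_of _ _ (@sgval G H) (fun _ _ => erefl)) val_inj.

Lemma cosetM_normal (G : finGroupType) (N : {group G})
    (nN : (N <| [set: G]%SET)%g) :
  {morph coset N : x y / (x * y)%g}.
Proof.
move=> x y; have nNG z : z \in 'N(N)%g.
  by apply: (fintype.subsetP (normal_norm nN)); rewrite inE.
by rewrite morphM ?nNG.
Qed.

(* For [N] normal in the whole group, [coset_of N] is the quotient G/N. *)
Definition quo (G : finGroupType) (N : {group G}) (nN : (N <| [set: G]%SET)%g) :
  hom G (coset_of N) := hom_of (cosetM_normal nN).

Section Mackey.
Variables (H K G : finGroupType) (a : mono H G) (b : mono K G).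

(* With the conventions [A :^ x = x^-1 A x] and [y ^ x = x^-1 y x], this is
   a(H) \cap g b(K) g^-1. *)
Definition mackey_grp (g : G) : {group G} := (img a :&: img b :^ g^-1)%G.

Definition mackey_phi_fun (g : G) (x : subg_of (mackey_grp g)) : K :=
  mono_inv b (sgval x ^ g)%g.

Definition mackey_psi_fun (g : G) (x : subg_of (mackey_grp g)) : H :=
  mono_inv a (sgval x).

Lemma mackey_imgl g (x : subg_of (mackey_grp g)) : sgval x \in img a.
Proof. by case: x => x /=; case/setIP. Qed.

Lemma mackey_imgr g (x : subg_of (mackey_grp g)) : (sgval x ^ g)%g \in img b.
Proof.
by case: x => x /=; case/setIP => _; rewrite mem_conjgV.
Qed.

Lemma mackey_phiM g : {morph @mackey_phi_fun g : x y / (x * y)%g}.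
Proof.
by move=> x y; rewrite /mackey_phi_fun -mono_invM ?mackey_imgr // -conjMg.
Qed.

Lemma mackey_psiM g : {morph @mackey_psi_fun g : x y / (x * y)%g}.
Proof. by move=> x y; rewrite /mackey_psi_fun -mono_invM ?mackey_imgl. Qed.

Lemma mackey_phi_inj g : injective (hom_of (@mackey_phiM g)).
Proof.
move=> x y /(congr1 b); rewrite !mono_invK ?mackey_imgr //.
by move/conjg_inj/val_inj.
Qed.

Definition mackey_phi (g : G) : mono (subg_of (mackey_grp g)) K :=
  Mono (@mackey_phi_inj g).

Definition mackey_psi (g : G) : hom (subg_of (mackey_grp g)) H :=
  hom_of (@mackey_psiM g).

Definition double_cosets : {set {set G}} :=
  [set (img a :* g * img b)%g | g in [set: G]%SET]%SET.

End Mackey.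

Section MFI.
Variable R : comNzRingType.

(* In [mfi5] the summand does not depend on the representative, by [mfi1],
   [mfi2] and [mfi3]; we sum over the chosen representatives [fingroup.repr]. *)
Record mackey_structure (M : finGroupType -> lmodType R) := MackeyStructure {
  ind : forall H G : finGroupType, mono H G -> {linear M H -> M G};
  res : forall H G : finGroupType, hom H G -> {linear M G -> M H};
  mfi1 : forall (K H G : finGroupType) (a : mono H G) (b : mono K H) (x : M K),
    ind (mono_comp a b) x = ind a (ind b x);
  mfi2 : forall (K H G : finGroupType) (a : hom H G) (b : hom K H) (x : M G),
    res (a \o b) x = res b (res a x);
  mfi3 : forall (G : finGroupType) (a : mono G G) (g : G),
    (forall y, a y = g * y * g^-1)%g ->
    forall x : M G, res a x = x /\ ind a x = x;
  mfi4 : forall (G : finGroupType) (a a' : mono G G),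
    cancel a a' -> cancel a' a ->
    forall x : M G, ind a x = res a' x;
  mfi5 : forall (H K G : finGroupType) (a : mono H G) (b : mono K G) (x : M H),
    res b (ind a x) =
    \sum_(D in double_cosets a b)
      ind (mackey_phi a b (fingroup.repr D))
          (res (mackey_psi a b (fingroup.repr D)) x);
  mfi6 : forall (H Hb G Gb : finGroupType)
      (a : mono H G) (b : mono Hb Gb) (e : hom H Hb) (d : hom G Gb),
    epi e -> epi d -> (forall y, d (a y) = b (e y)) ->
    (a @: [set: H] = d @^-1: (b @: [set: Hb]))%SET ->
    forall x : M Hb, res d (ind b x) = ind a (res e x)
}.

Record MFI := MkMFI {
  mfi_obj :> finGroupType -> lmodType R;
  mfi_str :> mackey_structure mfi_obj
}.

Definition Ind (M : MFI) (G : finGroupType) (H : {group G}) :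
  {linear M (subg_of H) -> M G} := ind M (incl H).

Definition Inf (M : MFI) (G : finGroupType) (N : {group G})
    (nN : (N <| [set: G]%SET)%g) : {linear M (coset_of N) -> M G} :=
  res M (quo nN).

Definition ind_ideal (M : MFI) (G : finGroupType) : set (M G) :=
  Rspan (\bigcup_(H in [set H : {group G} | H \proper [set: G]%SET])
           range (Ind M H)).

Arguments ind_ideal : clear implicits.

Definition primordial (M : MFI) (G : finGroupType) : Prop :=
  #|G| = 1%N \/ ind_ideal M G <> [set: M G].

Record subMFI (M : MFI) := SubMFI {
  sub_set :> forall G, set (M G);
  sub_submodule : forall G, submodule (@sub_set G);
  sub_ind : forall (H G : finGroupType) (a : mono H G) x,
    @sub_set H x -> @sub_set G (ind M a x);
  sub_res : forall (H G : finGroupType) (a : hom H G) x,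
    @sub_set G x -> @sub_set H (res M a x)
}.

End MFI.

Arguments ind_ideal {R} M G _.
Arguments sub_set {R M} s G _ : rename.

Section SubMFI.
Variables (R : comNzRingType) (M : MFI R) (S : subMFI M).

Section Carrier.
Variable G : finGroupType.

Definition sub_pred : {pred M G} := [in S G].

Lemma sub_pred_closed : GRing.submod_closed sub_pred.
Proof. exact: sub_submodule. Qed.

HB.instance Definition _ :=
  GRing.isSubmodClosed.Build R (M G) sub_pred sub_pred_closed.

Record sub_obj := SubObj {
  sub_val : M G;
  sub_valP : sub_val \in sub_pred
}.

HB.instance Definition _ := [isSub for sub_val].
HB.instance Definition _ := [Choice of sub_obj by <:].
HB.instance Definition _ := [SubChoice_isSubLmodule of sub_obj by <:].

Lemma sub_obj_set (x : sub_obj) : S G (sub_val x).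
Proof. by have := sub_valP x; rewrite in_setE. Qed.

End Carrier.

Arguments sub_pred : clear implicits.

Section Maps.
Variables (H G : finGroupType).

Lemma sub_ind_subproof (a : mono H G) (x : sub_obj H) :
  ind M a (sub_val x) \in sub_pred G.
Proof. by rewrite in_setE; apply/sub_ind/sub_obj_set. Qed.

Lemma sub_res_subproof (a : hom H G) (x : sub_obj G) :
  res M a (sub_val x) \in sub_pred H.
Proof. by rewrite in_setE; apply/sub_res/sub_obj_set. Qed.

Definition sub_ind_fun (a : mono H G) (x : sub_obj H) : sub_obj G :=
  SubObj (sub_ind_subproof a x).

Definition sub_res_fun (a : hom H G) (x : sub_obj G) : sub_obj H :=
  SubObj (sub_res_subproof a x).

Lemma sub_ind_linear a : linear (sub_ind_fun a).
Proof.
move=> r x y; apply: val_inj.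
rewrite [RHS](@linearP _ _ _ _ (val : sub_obj G -> M G)) /=.
by rewrite -[in RHS]linearP; congr (ind M a _); exact: (linearP (val : sub_obj H -> M H)).
Qed.

Lemma sub_res_linear a : linear (sub_res_fun a).
Proof.
move=> r x y; apply: val_inj.
rewrite [RHS](@linearP _ _ _ _ (val : sub_obj H -> M H)) /=.
by rewrite -[in RHS]linearP; congr (res M a _); exact: (linearP (val : sub_obj G -> M G)).
Qed.

HB.instance Definition _ a :=
  GRing.isLinear.Build R (sub_obj H) (sub_obj G) *:%R (sub_ind_fun a)
    (sub_ind_linear a).
HB.instance Definition _ a :=
  GRing.isLinear.Build R (sub_obj G) (sub_obj H) *:%R (sub_res_fun a)
    (sub_res_linear a).

End Maps.

Definition sub_structure : mackey_structure (fun G => sub_obj G : lmodType R).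
Proof.
apply: (@MackeyStructure R _ (fun H G a => @sub_ind_fun H G a)
                             (fun H G a => @sub_res_fun H G a)).
- by move=> K H G a b x; apply: val_inj; rewrite /= mfi1.
- by move=> K H G a b x; apply: val_inj; rewrite /= mfi2.
- move=> G a g ag x.
  have [rx ix] := mfi3 M ag (sub_val x).
  by split; apply: val_inj.
- by move=> G a a' aK a'K x; apply: val_inj; rewrite /= (mfi4 M aK a'K).
- move=> H K G a b x; apply: val_inj.
  rewrite (raddf_sum (val : sub_obj K -> M K)) /= mfi5.
  by apply: eq_bigr.
- move=> H Hb G Gb a b e d he hd sq cart x; apply: val_inj => /=.
  exact: mfi6.
Defined.

Definition subMFI_MFI : MFI R := MkMFI sub_structure.

End SubMFI.

Arguments sub_pred {R M} S G _.

Section GFI.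
Variable R : comNzRingType.

Record GFI := MkGFI {
  gfi_obj :> finGroupType -> ralgebra R;
  gfi_str : mackey_structure (fun G => gfi_obj G : lmodType R);
  gfi_res_mul : forall (H G : finGroupType) (a : hom H G),
    GRing.monoid_morphism (res gfi_str a : gfi_obj G -> gfi_obj H);
  gfi_frobl : forall (H G : finGroupType) (a : mono H G)
      (x : gfi_obj H) (y : gfi_obj G),
    (ind gfi_str a x : gfi_obj G) * y = ind gfi_str a (x * res gfi_str a y);
  gfi_frobr : forall (H G : finGroupType) (a : mono H G)
      (x : gfi_obj H) (y : gfi_obj G),
    y * (ind gfi_str a x : gfi_obj G) = ind gfi_str a (res gfi_str a y * x)
}.

Definition GFI_MFI (F : GFI) : MFI R := MkMFI (gfi_str F).

Record GFI_morphism (F F' : GFI) := MkGFIMorphism {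
  gmor :> forall G : finGroupType, {linear F G -> F' G};
  gmor_mul : forall G, GRing.monoid_morphism (gmor G);
  gmor_ind : forall (H G : finGroupType) (a : mono H G) (x : F H),
    gmor G (ind (gfi_str F) a x) = ind (gfi_str F') a (gmor H x);
  gmor_res : forall (H G : finGroupType) (a : hom H G) (x : F G),
    gmor H (res (gfi_str F) a x) = res (gfi_str F') a (gmor G x)
}.

Section KerIm.
Variables (F F' : GFI) (m : GFI_morphism F F').

Definition ker_set (G : finGroupType) : set (F G) := [set x | m G x = 0].

Definition im_set (G : finGroupType) : set (F' G) := range (m G).

Definition GFI_ker : subMFI (GFI_MFI F).
Proof.
apply: (@SubMFI R (GFI_MFI F) ker_set).
- move=> G; apply/submoduleP; split; first exact: linear0.
  by move=> r x y mx my; rewrite /ker_set /= linearP mx my scaler0 addr0.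
- by move=> H G a x mx; rewrite /ker_set /= gmor_ind mx linear0.
- by move=> H G a x mx; rewrite /ker_set /= gmor_res mx linear0.
Defined.

Definition GFI_im : subMFI (GFI_MFI F').
Proof.
apply: (@SubMFI R (GFI_MFI F') im_set).
- move=> G; apply/submoduleP; split; first by exists 0; rewrite ?linear0.
  by move=> r _ _ [x _ <-] [y _ <-]; exists (r *: x + y); rewrite ?linearP.
- by move=> H G a _ [x _ <-]; exists (ind (gfi_str F) a x); rewrite ?gmor_ind.
- by move=> H G a _ [x _ <-]; exists (res (gfi_str F) a x); rewrite ?gmor_res.
Defined.

End KerIm.

Section Prim.
Variables (F : GFI) (K : subMFI (GFI_MFI F)).
Variables (G : finGroupType) (D : set (F G)).

Definition induced_from_proper : set (F G) :=
  \bigcup_(H in [set H : {group G} | H \proper [set: G]%SET])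
    (Ind (GFI_MFI F) H @` K (subg_of H)).

Definition inflated_from_quotient : set (F G) :=
  [set y | exists (N : {group G}) (nN : (N <| [set: G]%SET)%g),
     N != 1%G /\ (Inf (GFI_MFI F) nN @` K (coset_of N)) y].

Definition Imprim : set (F G) :=
  Rspan [set d * k | d in D &
                     k in Rspan (induced_from_proper `|` inflated_from_quotient)].

(* [sub_obj K G] is K(G) as a module of its own; nothing is lost in pulling
   [Imprim] back to it, see [Imprim_sub_ker]. *)
Definition Imprim_pred : {pred sub_obj K G} :=
  [pred x : sub_obj K G | (sub_val x : F G) \in Imprim].

Lemma Imprim_closed : GRing.submod_closed Imprim_pred.
Proof.
have [I0 IS] : submodule Imprim by exact: Rspan_submodule.
split=> [|r x y Ix Iy].
  have e : (sub_val (0 : sub_obj K G) : F G) = 0.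
    exact: (linear0 (val : sub_obj K G -> _)).
  by rewrite -[X in is_true X]/((sub_val (0 : sub_obj K G) : F G) \in Imprim) e.
have e : (sub_val (r *: x + y) : F G) = r *: (sub_val x : F G) + sub_val y.
  exact: (linearP (val : sub_obj K G -> _)).
rewrite -[X in is_true X]/((sub_val (r *: x + y) : F G) \in Imprim) e.
exact: IS.
Qed.

HB.instance Definition _ :=
  GRing.isSubmodClosed.Build R (sub_obj K G) Imprim_pred Imprim_closed.

(* [{ideal_quot I}] is the quotient by any additive subgroup [I]. *)
Definition Prim : Type := {ideal_quot Imprim_pred}.

HB.instance Definition _ := GRing.Zmodule.on Prim.
HB.instance Definition _ := EqQuotient.on Prim.

Definition Prim_scale (r : R) (x : Prim) : Prim :=
  \pi_Prim (r *: generic_quotient.repr x).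

Lemma Prim_scale_pi r x : Prim_scale r (\pi_Prim x) = \pi_Prim (r *: x).
Proof.
apply/eqP; rewrite /Prim_scale -Quotient.idealrBE -scalerBr.
by apply: rpredZ; rewrite Quotient.idealrBE reprK.
Qed.

Lemma Prim_piD (x y : sub_obj K G) : \pi_Prim (x + y) = \pi_Prim x + \pi_Prim y.
Proof. exact: (@Quotient.pi_add _ Imprim_pred x y). Qed.

Lemma Prim_elim (P : Prim -> Prop) :
  (forall x : sub_obj K G, P (\pi_Prim x)) -> forall x, P x.
Proof. by move=> Ppi x; rewrite -[x]reprK; apply: Ppi. Qed.

Lemma Prim_scaleA r s x : Prim_scale r (Prim_scale s x) = Prim_scale (r * s) x.
Proof. by elim/Prim_elim: x => x; rewrite 3!Prim_scale_pi scalerA. Qed.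

Lemma Prim_scale1 : left_id 1 Prim_scale.
Proof. by elim/Prim_elim => x; rewrite Prim_scale_pi scale1r. Qed.

Lemma Prim_scaleDr : right_distributive Prim_scale +%R.
Proof.
move=> r; elim/Prim_elim => x; elim/Prim_elim => y.
by rewrite -Prim_piD 3!Prim_scale_pi scalerDr Prim_piD.
Qed.

Lemma Prim_scaleDl x : {morph Prim_scale^~ x : r s / r + s}.
Proof.
by elim/Prim_elim: x => x r s; rewrite 3!Prim_scale_pi scalerDl Prim_piD.
Qed.

HB.instance Definition _ := GRing.Zmodule_isLmodule.Build R Prim
  Prim_scaleA Prim_scale1 Prim_scaleDr Prim_scaleDl.

End Prim.

End GFI.

Arguments ker_set {R F F'} m G _.
Arguments im_set {R F F'} m G _.
Arguments induced_from_proper {R F} K G _.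
Arguments inflated_from_quotient {R F} K G _.
Arguments Imprim {R F} K G D _.
Arguments Imprim_pred {R F} K G D _.
Arguments Prim {R F} K G D.

Lemma Imprim_sub_ker (R : comNzRingType) (F F' : GFI R) (m : GFI_morphism F F')
    (G : finGroupType) (D : set (F G)) :
  Imprim (GFI_ker m) G D `<=` GFI_ker m G.
Proof.
set K := GFI_ker m.
pose S : set (F G) :=
  Rspan (induced_from_proper K G `|` inflated_from_quotient K G).
have SK : S `<=` K G.
  move=> x; apply; split; first exact: sub_submodule.
  move=> y [[H _ [z Kz <-]]|[N [nN [_ [z Kz <-]]]]].
  - exact: (@sub_ind _ _ K _ _ (incl H) z Kz).
  - exact: (@sub_res _ _ K _ _ (quo nN) z Kz).
move=> x; apply; split; first exact: sub_submodule.
move=> _ [d _ [k /SK Kk <-]].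
by rewrite /= /ker_set /= (gmor_mul m G).2 Kk mulr0.
Qed.

(* Main.v *)
Require Import Defs.
From HB Require Import structures.
From mathcomp Require Import all_boot all_order all_algebra all_fingroup.
From mathcomp Require Import boolp classical_sets.

(** Write Q = G/N. As Q is not primordial for Im m, the unit of (Im m)(Q) is a
    sum of elements induced from proper subgroups of Q. Lifting the summands
    through m gives y in I_F(Q) with m(y) = 1 ([ind_ideal_im_lift]), so that
    1 - y lies in K(Q). Inflation to G commutes with induction along cartesian
    squares, hence z = Inf y lies in I_F(G) ([res_epi_ind_ideal]), while
    1 - z = Inf (1 - y) is one of the generators of Imprim_{K,D}(G), because
    N is non-trivial.

    Any x in K(G) is now x * z + x * (1 - z). By Frobenius reciprocity, a
    product of an element of I_F(G) with an element of the ideal K(G), on either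
    side, is induced from proper subgroups inside K ([ind_ideal_mulr],
    [ind_ideal_mull]). This handles x * z. For x * (1 - z), expand x as a
    combination of elements of I_F(G) and of D: the former contribute induced
    elements of K(G) again since 1 - z is in K(G), and the latter contribute
    elements of D * Inf K(G/N). So x lies in Imprim_{K,D}(G). *)

Set Implicit Arguments.
Unset Strict Implicit.
Unset Printing Implicit Defensive.

Import GRing.Theory.

Local Open Scope classical_set_scope.
Local Open Scope ring_scope.

Local Notation hom H G := (UMagmaMorphism.type H G).

(** * Submodules *)

Section Span.
Variables (R : pzRingType) (V : lmodType R).

Lemma sub_Rspan (A : set V) : A `<=` Rspan A.
Proof. exact: sub_gen_smallest. Qed.

Lemma Rspan_min (A S : set V) : submodule S -> A `<=` S -> Rspan A `<=` S.
Proof. exact: smallest_sub. Qed.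

Lemma submodule_preimage (W : lmodType R) (f : {linear V -> W}) (S : set W) :
  submodule S -> submodule (f @^-1` S).
Proof.
move=> /submoduleP[S0 SD]; apply/submoduleP.
split=> [|a x y Sx Sy]; rewrite /preimage /=; first by rewrite linear0.
by rewrite linearP; apply: SD.
Qed.

Lemma submodule_image (W : lmodType R) (f : {linear V -> W}) (S : set V) :
  submodule S -> submodule (f @` S).
Proof.
move=> /submoduleP[S0 SD]; apply/submoduleP.
split=> [|a _ _ [x Sx <-] [y Sy <-]]; first by exists 0; rewrite ?linear0.
by exists (a *: x + y); rewrite ?linearP //; apply: SD.
Qed.

End Span.

Section Mult.
Variables (R : comNzRingType) (A : ralgebra R).

Lemma ralg_scalerAl (a : R) (x y : A) : (a *: x) * y = a *: (x * y).
Proof. by rewrite /GRing.scale /= /alg_scale mulrA. Qed.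

Lemma ralg_scalerAr (a : R) (x y : A) : x * (a *: y) = a *: (x * y).
Proof.
rewrite /GRing.scale /= /alg_scale !mulrA; congr (_ * _).
by rewrite -[LHS](alg_central a x).
Qed.

Lemma submodule_mulr (S : set A) (y : A) :
  submodule S -> submodule [set x | S (x * y)].
Proof.
move=> /submoduleP[S0 SD]; apply/submoduleP.
split=> [|a u v Su Sv] /=; first by rewrite mul0r.
by rewrite mulrDl ralg_scalerAl; apply: SD.
Qed.

Lemma submodule_mull (S : set A) (x : A) :
  submodule S -> submodule [set y | S (x * y)].
Proof.
move=> /submoduleP[S0 SD]; apply/submoduleP.
split=> [|a u v Su Sv] /=; first by rewrite mulr0.
by rewrite mulrDr ralg_scalerAr; apply: SD.
Qed.

End Mult.

(** * Restriction along epimorphisms *)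

Section Preimage.
Variables (G Q : finGroupType) (d : hom G Q) (H : {group Q}).

Lemma preim_group_set : group_set (d @^-1: H)%SET.
Proof.
apply/group_setP; split=> [|x y]; rewrite !inE ?gmulf1 ?group1 // gmulfM.
exact: groupM.
Qed.

Definition preim_group : {group G} := Group preim_group_set.

Lemma preim_restr_subproof (x : subg_of preim_group) : d (sgval x) \in H.
Proof. by have := subgP x; rewrite inE. Qed.

Definition preim_restr_fun (x : subg_of preim_group) : subg_of H :=
  Subg (preim_restr_subproof x).

Lemma preim_restrM : {morph preim_restr_fun : x y / (x * y)%g}.
Proof. by move=> x y; apply: val_inj; rewrite /= gmulfM. Qed.

Definition preim_restr : hom (subg_of preim_group) (subg_of H) :=
  hom_of preim_restrM.

Hypothesis d_epi : epi d.

Lemma preim_restr_epi : epi preim_restr.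
Proof.
move=> y; have [x dx] := d_epi (sgval y).
have xH : x \in preim_group by rewrite inE dx subgP.
by exists (Subg xH); apply: val_inj.
Qed.

Lemma preim_group_proper :
  H \proper [set: Q]%SET -> preim_group \proper [set: G]%SET.
Proof.
move=> /properP[_ [y _ yH]]; apply/properP; split; first exact: finset.subsetT.
have [x dx] := d_epi y.
by exists x; rewrite ?inE // dx.
Qed.

Lemma img_incl (L : finGroupType) (M : {group L}) :
  (incl M @: [set: subg_of M] = M)%SET.
Proof.
apply/setP=> x; apply/imsetP/idP=> [[y _ ->]|xM]; first exact: subgP.
by exists (Subg xM).
Qed.

Lemma res_epi_Ind (R : comNzRingType) (M : MFI R) (x : M (subg_of H)) :
  res M d (Ind M H x) = Ind M preim_group (res M preim_restr x).
Proof.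
apply: mfi6 => //; first exact: preim_restr_epi.
by rewrite !img_incl.
Qed.

End Preimage.

(** The inclusion of a proper subgroup H of Q and that of its preimage, which is
    proper because d is onto, form a cartesian square with d. So the restriction
    of an element induced from H is induced from the preimage. *)
Lemma res_epi_ind_ideal (R : comNzRingType) (M : MFI R) (G Q : finGroupType)
    (d : hom G Q) :
  epi d -> forall y, ind_ideal M Q y -> ind_ideal M G (res M d y).
Proof.
move=> d_epi; apply: Rspan_min; first exact/submodule_preimage/Rspan_submodule.
move=> _ [H properH [x _ <-]]; apply: sub_Rspan.
exists (preim_group d H); first exact: preim_group_proper.
by exists (res M (preim_restr d H) x); rewrite ?res_epi_Ind.
Qed.

Lemma quo_epi (G : finGroupType) (N : {group G})
    (nN : (N <| [set: G]%SET)%g) : epi (quo nN).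
Proof. by move=> y; exists (fingroup.repr y); exact: coset_reprK. Qed.

(** * The image of a morphism *)

(** An element of Im m at H lifts to F(H), and m commutes with induction. *)
Lemma ind_ideal_im_lift (R : comNzRingType) (F F' : GFI R)
    (m : GFI_morphism F F') (G : finGroupType)
    (x : subMFI_MFI (GFI_im m) G) :
  ind_ideal (subMFI_MFI (GFI_im m)) G x ->
  exists2 y, ind_ideal (GFI_MFI F) G y & m G y = sub_val x.
Proof.
pose v : {linear sub_obj (GFI_im m) G -> F' G} := val.
suff sub : ind_ideal (subMFI_MFI (GFI_im m)) G
    `<=` v @^-1` (m G @` ind_ideal (GFI_MFI F) G) by move/sub.
apply: Rspan_min.
  exact/submodule_preimage/submodule_image/Rspan_submodule.
move=> _ [H properH [w _ <-]].
have [z _ mz] := sub_obj_set w.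
exists (Ind (GFI_MFI F) H z).
  by apply: sub_Rspan; exists H => //; exists z.
by rewrite gmor_ind mz.
Qed.

(** * Ideals of a Green functor *)

Section Ideal.
Variables (R : comNzRingType) (F : GFI R) (K : subMFI (GFI_MFI F)).
Hypothesis K_mull : forall G (x y : F G), K G y -> K G (x * y).
Hypothesis K_mulr : forall G (x y : F G), K G x -> K G (x * y).
Variable G : finGroupType.

(** By Frobenius reciprocity, Ind(w) * k = Ind(w * Res k), and w * Res k is in K
    because K is an ideal stable under restriction. *)
Lemma ind_ideal_mulr (z k : F G) :
  ind_ideal (GFI_MFI F) G z -> K G k -> Rspan (induced_from_proper K G) (z * k).
Proof.
move=> Iz Kk; move: z Iz; apply: Rspan_min.
  exact/submodule_mulr/Rspan_submodule.
move=> _ [H properH [w _ <-]]; apply: sub_Rspan; exists H => //.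
exists (w * res (gfi_str F) (incl H) k); last by rewrite /= -gfi_frobl.
exact/K_mull/(@sub_res _ _ K).
Qed.

Lemma ind_ideal_mull (z k : F G) :
  ind_ideal (GFI_MFI F) G z -> K G k -> Rspan (induced_from_proper K G) (k * z).
Proof.
move=> Iz Kk; move: z Iz; apply: Rspan_min.
  exact/submodule_mull/Rspan_submodule.
move=> _ [H properH [w _ <-]]; apply: sub_Rspan; exists H => //.
exists (res (gfi_str F) (incl H) k * w); last by rewrite /= -gfi_frobr.
exact/K_mulr/(@sub_res _ _ K).
Qed.

Variable D : set (F G).
Hypothesis D_1 : D 1.

Lemma induced_sub_Imprim : Rspan (induced_from_proper K G) `<=` Imprim K G D.
Proof.
apply: Rspan_min; first exact: Rspan_submodule.
move=> x x_ind; apply: sub_Rspan; exists 1 => //; exists x; last exact: mul1r.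
by apply: sub_Rspan; left.
Qed.

Lemma inflated_sub_ideal : inflated_from_quotient K G `<=` K G.
Proof. by move=> _ [N [nN [_ [x Kx <-]]]]; exact: (@sub_res _ _ K). Qed.

(** Split x as x * z + x * (1 - z); the second term is linear in the left
    factor, which may therefore be taken in I_F(G) or in D. *)
Lemma Imprim_full (z : F G) :
    Rspan (ind_ideal (GFI_MFI F) G `|` D) = [set: F G] ->
    ind_ideal (GFI_MFI F) G z -> inflated_from_quotient K G (1 - z) ->
  K G `<=` Imprim K G D.
Proof.
move=> genF Iz inf1z x Kx.
have /submoduleP[_ ImprimD] : submodule (Imprim K G D) by exact: Rspan_submodule.
have x1z : Imprim K G D (x * (1 - z)).
  suff sub : Rspan (ind_ideal (GFI_MFI F) G `|` D)
      `<=` [set y | Imprim K G D (y * (1 - z))] by apply: sub; rewrite genF.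
  apply: Rspan_min; first exact/submodule_mulr/Rspan_submodule.
  move=> y [Iy|Dy] /=.
    apply: induced_sub_Imprim; apply: ind_ideal_mulr => //.
    exact: inflated_sub_ideal.
  by apply: sub_Rspan; exists y => //; exists (1 - z) => //;
    apply: sub_Rspan; right.
have -> : x = 1 *: (x * z) + x * (1 - z).
  by rewrite scale1r mulrBr mulr1 addrCA subrr addr0.
by apply: ImprimD x1z; apply: induced_sub_Imprim; exact: ind_ideal_mull.
Qed.

Lemma Prim_trivial : K G `<=` Imprim K G D -> forall x : Prim K G D, x = 0.
Proof.
move=> sKI; elim/Prim_elim => x.
suff : x - 0 \in Imprim_pred K G D.
  by rewrite Quotient.idealrBE => /eqP ->; exact: pi_zeror.
rewrite subr0.
rewrite -[is_true _]/(is_true ((sub_val x : F G) \in Imprim K G D)) in_setE.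
by apply: sKI; exact: sub_obj_set.
Qed.

End Ideal.

(** * Vanishing of the primitive quotient *)

Theorem theorem4p6 (R : idomainType) (F F' : GFI R) (m : GFI_morphism F F')
    (F_torsion_free : forall H : finGroupType, torsion_free (F H))
    (G : finGroupType) (D : set (F G))
    (D_subalgebra : subalgebra D)
    (D_central : D `<=` centre (F G))
    (F_generated : Rspan (ind_ideal (GFI_MFI F) G `|` D) = [set: F G])
    (hN : exists (N : {group G}) (nN : (N <| [set: G]%SET)%g),
      N != 1%G /\ ~ primordial (subMFI_MFI (GFI_im m)) (coset_of N)) :
  forall x : Prim (GFI_ker m) G D, x = 0.
Proof.
have [N [nN [ntN nprimQ]]] := hN.
set Q := coset_of N in nprimQ.
have im1 : GFI_im m Q 1 by exists 1; rewrite ?(gmor_mul m Q).1.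
have [y Iy my] : exists2 y, ind_ideal (GFI_MFI F) Q y & m Q y = 1.
  have im1_in : 1 \in sub_pred (GFI_im m) Q by rewrite in_setE.
  apply: (@ind_ideal_im_lift _ _ _ m Q (SubObj im1_in)).
  have -> : ind_ideal (subMFI_MFI (GFI_im m)) Q = [set: _].
    by apply: contrapT => nfull; apply: nprimQ; right.
  by [].
apply: Prim_trivial.
apply: (@Imprim_full _ _ _ _ _ _ _ _ (Inf (GFI_MFI F) nN y)) => //.
- by move=> L u v Kv; rewrite /= /ker_set /= (gmor_mul m L).2 Kv mulr0.
- by move=> L u v Ku; rewrite /= /ker_set /= (gmor_mul m L).2 Ku mul0r.
- by have [_ [D1 _]] := D_subalgebra; rewrite -in_setE.
- by apply: res_epi_ind_ideal Iy; exact: quo_epi.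
- exists N, nN; split=> //; exists (1 - y).
    by rewrite /= /ker_set /= linearB /= my (gmor_mul m Q).1 subrr.
  by rewrite linearB /= (gfi_res_mul F (quo nN)).1.
Qed.
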